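(* Let $\Phi$ be a finite crystallographic root system and let $X\subseteq\Phi$ be a summable set with no vanishing subsum. Then for any $\alpha\in X$ there is a chain of summable subsets $\{\alpha\}=X_1\subsetneq X_2\subsetneq\dots\subsetneq X_{|X|-1}\subsetneq X_{|X|}=X$.
   Context: Let $V$ be a real Euclidean space with scalar product $\langle\cdot,\cdot\rangle$. For $\alpha\neq0$ let $\alpha^\vee=2\alpha/\langle\alpha,\alpha\rangle$ and $s_\alpha(v)=v-\langle\alpha^\vee,v\rangle\alpha$. A finite root system is a finite set $\Phi\subset V\setminus\{0\}$ with $\Phi\cap\mathbb{R}\alpha=\{\alpha,-\alpha\}$ and $s_\alpha\Phi=\Phi$ for all $\alpha\in\Phi$; it is crystallographic if $\langle\alpha^\vee,\beta\rangle\in\mathbb{Z}$ for all $\alpha,\beta\in\Phi$. A set $X\subseteq\Phi$ is summable if the sum of its elements is a root of $\Phi$, and has no vanishing subsum if the sum of every nonempty subset of $X$ is nonzero. *)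

(* Defs.v *)
From mathcomp Require Export all_boot all_order all_algebra.
From mathcomp Require Export finmap reals.

Set Implicit Arguments.
Unset Strict Implicit.
Unset Printing Implicit Defensive.

Import Order.TTheory GRing.Theory Num.Theory.
Local Open Scope fset_scope.
Local Open Scope ring_scope.

(* A real Euclidean space is a finite-dimensional real vector space V with a
   symmetric positive definite bilinear form dot : {dot V for idfun}. *)

Definition coroot (R : realType) (V : vectType R) (dot : {dot V for idfun})
    (a : V) : V :=
  (2 / dot a a) *: a.

Definition reflection (R : realType) (V : vectType R) (dot : {dot V for idfun})
    (a v : V) : V :=
  v - dot (coroot dot a) v *: a.

(* The first two conjuncts say that Phi is a (finite) subset of V \ {0} whose
   intersection with each line through a root a is {a, - a}; Phi need not
   span V. *)
Definition root_system (R : realType) (V : vectType R)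
    (dot : {dot V for idfun}) (Phi : {fset V}) : Prop :=
  [/\ 0 \notin Phi,
      forall a, a \in Phi ->
        forall v, (v \in Phi /\ exists c : R, v = c *: a) <->
                  (v = a \/ v = - a)
    & forall a, a \in Phi -> [fset reflection dot a v | v in Phi] = Phi].

Definition crystallographic (R : realType) (V : vectType R)
    (dot : {dot V for idfun}) (Phi : {fset V}) : Prop :=
  forall a b, a \in Phi -> b \in Phi -> dot (coroot dot a) b \is a Num.int.

Definition summable (R : realType) (V : vectType R) (Phi X : {fset V}) : Prop :=
  X `<=` Phi /\ \sum_(x <- X) x \in Phi.

Definition no_vanishing_subsum (R : realType) (V : vectType R)
    (X : {fset V}) : Prop :=
  forall Y : {fset V}, Y `<=` X -> Y != fset0 -> \sum_(y <- Y) y != 0.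

(* Main.v *)
Require Import Defs.
From mathcomp Require Import all_boot all_order all_algebra finmap reals.
From mathcomp Require Import lra.

Import Order.TTheory GRing.Theory Num.Theory.

Local Open Scope fset_scope.
Local Open Scope ring_scope.

(** Let [b] be the sum of a family of at least two roots without vanishing
    subsum, and [a] a member of it.  If some other member [x] has [(b, x) > 0],
    then [b - x] is a root, and [x] can be put last in the chain.  Otherwise,
    since [(b - a, b - a) > 0], some other member [x] has [(b - a, x) > 0] while
    [(b, x) <= 0]; so [(a, x) < 0] and [a + x] is a root, and [x] can be put
    second, replacing [a] and [x] by the single root [a + x].  This replacement
    may create repetitions, so the induction is over sequences, not sets. *)

Section RootChains.
Context {R : realType} {V : vectType R} {dot : {dot V for idfun}}.

Lemma dotC (u v : V) : dot u v = dot v u.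
Proof. by rewrite hermC expr0 mul1r. Qed.

Lemma dot_sumr (u : V) (s : seq V) :
  dot u (\sum_(v <- s) v) = \sum_(v <- s) dot u v.
Proof. exact: linear_sum. Qed.

Context {Phi : {fset V}}.
Hypotheses (hPhi : root_system dot Phi) (hcryst : crystallographic dot Phi).

Lemma root_neq0 a : a \in Phi -> a != 0.
Proof. by case: hPhi => Phi0 _ _; apply: contraTneq => ->. Qed.

Lemma root_opp a : a \in Phi -> - a \in Phi.
Proof. case: hPhi => _ line _ Pa.
by have [_ /(_ (or_intror erefl))[]] := line _ Pa (- a). Qed.

Lemma root_reflection a b : a \in Phi -> b \in Phi -> reflection dot a b \in Phi.
Proof.
by case: hPhi => _ _ refl Pa Pb; rewrite -(refl _ Pa) in_imfset.
Qed.

(** Both Cartan integers of the pair are positive. If one of them equals 1, the corresponding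
    reflection yields [b - a] or its opposite. If both are at least 2, then [(a, a)] and [(b, b)]
    are at most [(a, b)], which forces [a = b]. *)
Lemma root_subr {a b} : a \in Phi -> b \in Phi -> a != b -> 0 < dot a b ->
  b - a \in Phi.
Proof.
have int_cases u v : u \in Phi -> v \in Phi -> 0 < dot u v ->
    dot (coroot dot u) v = 1 \/ dot u u <= dot u v.
  move=> Pu Pv uv_gt0; have uu_gt0 := neq0_dnorm_gt0 (s := dot) _ (root_neq0 _ Pu).
  have cE : dot (coroot dot u) v = 2 / dot u u * dot u v by rewrite linearZl_LR.
  have c_gt0 : 0 < dot (coroot dot u) v by rewrite cE !mulr_gt0 ?invr_gt0.
  have /natrP[n nE] : dot (coroot dot u) v \is a Num.nat.
    by rewrite natrEint hcryst // ltW.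
  move: c_gt0; rewrite nE ltr0n; case: n nE => [//|[|n]] nE _; first by left.
  right; have : 2 <= dot (coroot dot u) v by rewrite nE ler_nat.
  by rewrite cE mulrAC ler_pdivlMr // ler_pM2l.
move=> Pa Pb ab_neq ab_gt0.
case: (int_cases a b Pa Pb ab_gt0) => [cab|aa_le].
  by have := root_reflection _ _ Pa Pb; rewrite /reflection cab scale1r.
have ba_gt0 : 0 < dot b a by rewrite dotC.
case: (int_cases b a Pb Pa ba_gt0) => [cba|bb_le].
  rewrite -opprB; apply: root_opp.
  by have := root_reflection _ _ Pb Pa; rewrite /reflection cba scale1r.
(* otherwise [(b - a, b - a) <= 0] *)
have := neq0_dnorm_gt0 (s := dot) (b - a).
rewrite subr_eq0 eq_sym ab_neq => /(_ isT).
rewrite linearBl linearBr linearBr /= (dotC b a) in bb_le *; lra.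
Qed.

Lemma root_addr {a b} : a \in Phi -> b \in Phi -> a + b != 0 -> dot a b < 0 ->
  a + b \in Phi.
Proof.
move=> Pa Pb ab_neq0 ab_lt0; rewrite addrC -[a]opprK.
apply: root_subr; rewrite ?root_opp // ?linearNl ?oppr_gt0 //=.
by rewrite -subr_eq0 -opprD oppr_eq0.
Qed.

(** Here [t] runs over the submultisets of [s], in any order, with [u] as complement; repeated
    entries count separately. *)
Definition no_zero_subsum (s : seq V) :=
  forall t u, perm_eq (t ++ u) s -> t != [::] -> \sum_(x <- t) x != 0.

Lemma perm_no_zero_subsum {s s'} : perm_eq s s' ->
  no_zero_subsum s -> no_zero_subsum s'.
Proof. by move=> /permPr ss' hs t u; rewrite -ss'; apply: hs. Qed.

Lemma no_zero_subsum_cons {x s} : no_zero_subsum (x :: s) -> no_zero_subsum s.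
Proof.
move=> hs t u tu; apply: (hs t (x :: u)).
by rewrite -cat1s perm_catCA perm_cons.
Qed.

(** A subfamily containing the merged entry has the same sum as the one with [x] and [y] in its
    place; otherwise [x] and [y] go to the complement. Since the value [x + y] may also occur in
    [s], just one occurrence of it is exchanged, by [rem]. *)
Lemma no_zero_subsum_merge {x y s} :
  no_zero_subsum (x :: y :: s) -> no_zero_subsum (x + y :: s).
Proof.
move=> hs t u tu t_neq0.
have := perm_mem tu (x + y); rewrite mem_head mem_cat => /orP[] xy_in.
  have rt := perm_to_rem xy_in; rewrite (perm_big _ rt) /=.
  rewrite big_cons -addrA.
  have := hs (x :: y :: rem (x + y) t) u; rewrite !big_cons; apply=> //.
  rewrite !perm_cons -(perm_cons (x + y)) -cat_cons.
  by rewrite -(permPr tu) perm_cat2r perm_sym.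
apply: (hs t (x :: y :: rem (x + y) u)) => //.
rewrite (perm_catCA t [:: x; y]) /= !perm_cons -(perm_cons (x + y)).
rewrite -(permPr tu) -cat1s perm_catCA perm_cat2l.
by rewrite perm_sym perm_to_rem.
Qed.

Lemma sum_gt0_exists (s : seq V) (f : V -> R) : 0 < \sum_(x <- s) f x ->
  exists2 x, x \in s & 0 < f x.
Proof.
move=> s_gt0; apply/hasP; apply: contraTT s_gt0 => /hasPn s_le0.
by rewrite -leNgt big_seq sumr_le0 // => x /s_le0; rewrite -leNgt.
Qed.

Lemma root_chain (n : nat) (a : V) (s : seq V) : size s = n ->
  {subset a :: s <= Phi} -> no_zero_subsum (a :: s) ->
  \sum_(x <- a :: s) x \in Phi ->
  exists2 t, perm_eq t s & forall k, \sum_(x <- a :: take k t) x \in Phi.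
Proof.
elim: n a s => [|n IHn] a s.
  by move/size0nil=> -> _ _ Pa; exists [::].
move=> s_size sP hs bP; set b := \sum_(x <- a :: s) x in bP.
have aP : a \in Phi by rewrite sP ?mem_head.
have [/hasP[x xs bx_gt0]|/hasPn b_le0] := boolP (has (fun x => 0 < dot b x) s).
  have rs := perm_to_rem xs.
  have rs' : perm_eq (a :: s) (x :: a :: rem x s).
    by rewrite -(perm_cons a) in rs; rewrite (permPl rs) (perm_catCA [:: a] [:: x]).
  have bE : b = x + \sum_(y <- a :: rem x s) y by rewrite /b (perm_big _ rs') big_cons.
  have hr := no_zero_subsum_cons (perm_no_zero_subsum rs' hs).
  (* The difference [b - x] is the sum of the nonempty subfamily [a :: rem x s], hence nonzero. *)
  have xb : x != b.
    by rewrite eq_sym -subr_eq0 bE addrAC subrr add0r (hr _ [::]) ?cats0.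
  have [||||t tr tP] := IHn a (rem x s).
  - by rewrite size_rem // s_size.
  - by move=> y; rewrite inE => /predU1P[-> //|/mem_rem ys]; rewrite sP // inE ys orbT.
  - exact: hr.
  - have -> : \sum_(y <- a :: rem x s) y = b - x by rewrite bE addrAC subrr add0r.
    by apply: root_subr => //; [rewrite sP // inE xs orbT | rewrite dotC].
  have tx : perm_eq (rcons t x) s by rewrite perm_rcons (permPr rs) perm_cons.
  (* Prefixes that stop before [x] are covered by induction; any longer one is the whole family,
     with sum [b]. *)
  exists (rcons t x) => // k; have [kt|tk] := leqP k (size t).
    by rewrite -cats1 takel_cat.
  rewrite take_oversize ?size_rcons //.
  by rewrite (perm_big (a :: s)) ?perm_cons.
have bE : b = a + \sum_(x <- s) x by rewrite /b big_cons.
have g_neq0 : \sum_(x <- s) x != 0.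
  by rewrite (no_zero_subsum_cons hs _ [::]) ?cats0 // -size_eq0 s_size.
have /= := neq0_dnorm_gt0 (s := dot) _ g_neq0.
rewrite [ltRHS]dot_sumr => /sum_gt0_exists[x xs gx_gt0].
(* With [b - a] the sum of [s], this is [(a, x) = (b, x) - (b - a, x)], where
   [(b, x) <= 0 < (b - a, x)]. *)
have ax_lt0 : dot a x < 0.
  have := b_le0 _ xs; rewrite -leNgt bE linearDl /=; lra.
have rs := perm_to_rem xs.
have hs' : no_zero_subsum [:: a, x & rem x s].
  by apply: perm_no_zero_subsum hs; rewrite perm_cons.
have ax_neq0 : a + x != 0.
  by have := hs' [:: a; x] (rem x s); rewrite !big_cons big_nil addr0; apply.
have axP : a + x \in Phi by apply: root_addr => //; rewrite sP // inE xs orbT.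
have [||||t tr tP] := IHn (a + x) (rem x s).
- by rewrite size_rem // s_size.
- by move=> y; rewrite inE => /predU1P[-> //|/mem_rem ys]; rewrite sP // inE ys orbT.
- exact: no_zero_subsum_merge.
- by move: bP; rewrite bE (perm_big _ rs) /= !big_cons addrA.
exists (x :: t); first by rewrite (permPr rs) perm_cons.
(* The empty prefix leaves the root [a]; every other one starts with [x] and has the sum of a prefix
   of the merged family. *)
case=> [|k]; first by rewrite take0 big_cons big_nil addr0.
by have := tP k; rewrite /= !big_cons addrA.
Qed.

End RootChains.

Lemma perm_fset_seq (K : choiceType) (s : seq K) : uniq s ->
  perm_eq [fset x in s] s.
Proof. by move=> s_uniq; apply: uniq_perm => // x; rewrite inE. Qed.

(** The enumeration of [X] has no repetitions, so its subfamilies are exactly its subsets. *)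
Lemma no_vanishing_subsum_seq (R : realType) (V : vectType R) (X : {fset V}) :
  no_vanishing_subsum X -> no_zero_subsum X.
Proof.
move=> hX t u tu t_neq0.
have : uniq (t ++ u) by rewrite (perm_uniq tu) fset_uniq.
rewrite cat_uniq => /andP[t_uniq _].
rewrite -(perm_big _ (perm_fset_seq _ _ t_uniq)) hX //.
  by apply/fsubsetP=> x; rewrite inE -(perm_mem tu) mem_cat => ->.
case: t t_neq0 {tu t_uniq} => // x t _.
by apply/fset0Pn; exists x; rewrite in_fset mem_head.
Qed.

Theorem theorem2p4 (R : realType) (V : vectType R) (dot : {dot V for idfun})
    (Phi : {fset V}) (hPhi : root_system dot Phi)
    (hcryst : crystallographic dot Phi)
    (X : {fset V}) (hX : summable Phi X) (hsub : no_vanishing_subsum X)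
    (a : V) (ha : a \in X) :
  exists C : nat -> {fset V},
    [/\ C 1%N = [fset a],
        C #|` X| = X,
        (forall i, (1 <= i <= #|` X|)%N -> summable Phi (C i))
      & (forall i, (1 <= i < #|` X|)%N -> C i `<` C i.+1)].
Proof.
case: hX => /fsubsetP XPhi sumX.
have rX := perm_to_rem ha.
have [|||t tr tP] := root_chain hPhi hcryst _ a (rem a X) erefl.
- by move=> x; rewrite -(perm_mem rX); apply: XPhi.
- exact: perm_no_zero_subsum rX (no_vanishing_subsum_seq _ _ _ hsub).
- by rewrite -(perm_big _ rX).
have tX : perm_eq (a :: t) X by rewrite (permPr rX) perm_cons.
have at_uniq : uniq (a :: t) by rewrite (perm_uniq tX) fset_uniq.
have szX : #|` X| = (size t).+1 by rewrite -(perm_size tX).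
(* The shift accounts for [a], so that [C i] has [i] elements for [i] from 1 to the size of [X];
   [C 0] is a junk value equal to [C 1]. *)
pose C i := [fset x in a :: take i.-1 t].
have take_uniq k : uniq (a :: take k t) by apply: (take_uniq k.+1 at_uniq).
exists C; split.
- by apply/fsetP=> x; rewrite /C take0 in_fset mem_seq1 in_fset1.
- by apply/fsetP=> x; rewrite szX /C take_size in_fset -(perm_mem tX).
- move=> i _; split.
    apply/fsubsetP=> x; rewrite in_fset => xC; apply: XPhi.
    by rewrite -(perm_mem tX); apply: (mem_take (n0 := i.-1.+1)).
  by rewrite (perm_big _ (perm_fset_seq _ _ (take_uniq _))).
(* Strictness comes from comparing cardinals, which are lengths of prefixes because [a :: t] is
   duplicate-free. *)
case=> // i; rewrite szX ltnS => /= it; rewrite fproperEcard; apply/andP; split.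
  apply/fsubsetP=> x; rewrite !in_fset /= !inE => /predU1P[->|]; first by rewrite eqxx.
  by rewrite -(take_takel t (leqnSn i)) => /mem_take ->; rewrite orbT.
rewrite !(perm_size (perm_fset_seq _ _ (take_uniq _))) /= !size_take_min.
by rewrite ltnS !(minn_idPl _) // ltnW.
Qed.
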